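(* Let $W$ be a binary-input discrete memoryless channel, let $N=2^n$, and consider a polar code of length $N$ and dimension $K$ with set of unfrozen indices $\mathcal A\subseteq\{1,\dots,N\}$, $|\mathcal A|=K$, frozen bits equal to $0$, and $N\in\mathcal A$. Let $K_1=2^{k_1}$ be the largest power of two such that $\{N-K_1+1,\dots,N\}\subseteq\mathcal A$. Suppose that the true values of all bits $u_1,\dots,u_{N-K_1}$ are supplied correctly to the decoder by a genie. Then, for decoding the remaining bits $u_{N-K_1+1},\dots,u_N$ from the channel output $y_1^N$ and the known bits $u_1^{N-K_1}$, the successive cancellation (SC) decoder achieves exactly the same performance as the maximum likelihood (ML) decoder; that is, when the unfrozen bits are independent and uniformly distributed, the probability that $\hat u_{N-K_1+1}^N\neq u_{N-K_1+1}^N$ is the same for both decoders.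
   Context: Notation: $a_i^j=(a_i,\dots,a_j)$; $\oplus$ is addition mod $2$. Channel: $W:\mathcal X\to\mathcal Y$, $\mathcal X=\{0,1\}$, with transition probabilities $W(y|x)$, used $N$ times independently: $y_1^N$ is received with probability $\prod_{i=1}^N W(y_i|c_i)$ when $c_1^N$ is sent. Polar code: the generator matrix is $G_N=B_NG_2^{\otimes n}$, where $G_2=\begin{pmatrix}1&0\\1&1\end{pmatrix}$, $\otimes n$ is the $n$-th Kronecker power and $B_N$ is the $N\times N$ bit-reversal permutation matrix. The codeword is $c_1^N=u_1^NG_N$ over $\mathbb F_2$, where $u_1^N\in\{0,1\}^N$ has $u_i=0$ for the $N-K$ frozen indices $i\notin\mathcal A$ and arbitrary information values for the $K$ unfrozen indices $i\in\mathcal A$ (in a polar code, $\mathcal A$ consists of the indices of the $K$ most reliable of the subchannels $W_N^{(i)}$ below). Subchannels: with $W_N(y_1^N|u_1^N)=\prod_{i=1}^N W(y_i|c_i)$, $c_1^N=u_1^NG_N$, $$W_N^{(i)}(y_1^N,u_1^{i-1}|u_i)=\sum_{u_{i+1}^N\in\mathcal X^{N-i}}\frac1{2^{N-1}}W_N(y_1^N|u_1^N).$$ SC decoder: it processes $i$ in increasing order. Here, for $i=N-K_1+1,\dots,N$, using the previous estimates (with $\hat u_j=u_j$, the true value, for $j\le N-K_1$), it computes $L(u_i)=\log\frac{W_N^{(i)}(y_1^N,\hat u_1^{i-1}|0)}{W_N^{(i)}(y_1^N,\hat u_1^{i-1}|1)}$ and sets $\hat u_i=0$ if $L(u_i)>0$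 and $\hat u_i=1$ if $L(u_i)<0$ (ties broken arbitrarily). ML decoder: given $y_1^N$ and the known bits $u_1^{N-K_1}$, it outputs some $\hat u_{N-K_1+1}^N\in\{0,1\}^{K_1}$ maximizing $W_N(y_1^N|u_1^{N-K_1},\hat u_{N-K_1+1}^N)$. *)

(* Defs.v *)
From mathcomp Require Import all_boot all_order all_algebra.
From mathcomp Require Import mxtens.
From mathcomp Require Import reals constructive_ereal exp.

Set Implicit Arguments.
Unset Strict Implicit.
Unset Printing Implicit Defensive.

Import Order.TTheory GRing.Theory Num.Theory.
Local Open Scope ring_scope.

(* Indices are 0-based: position i in {1, ..., N} is the ordinal i - 1 : 'I_N,
   with N = 2 ^ n.  Bits live in 'F_2, and words are row vectors. *)

(* [W x y] is the transition probability W(y|x). *)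
Definition is_dmc (R : realType) (Y : finType) (W : 'F_2 -> Y -> R) : Prop :=
  (forall x y, 0 <= W x y) /\ (forall x, \sum_(y : Y) W x y = 1).

Definition G2 : 'M['F_2]_2 := \matrix_(i, j) ((j <= i)%N)%:R.

(* The number whose n binary digits are those of i in reverse order. *)
Definition bitrev (n i : nat) : nat :=
  (\sum_(k < n) odd (i %/ 2 ^ k) * 2 ^ (n - 1 - k))%N.

Definition bitrev_mx (n : nat) : 'M['F_2]_(2 ^ n) :=
  \matrix_(i, j) (nat_of_ord j == bitrev n i)%:R.

Definition polar_mx (n : nat) : 'M['F_2]_(2 ^ n) := bitrev_mx n *m (G2 ^t n).

(* [polar_channel W y u] is W_N(y|u). *)
Definition polar_channel (R : realType) (Y : finType) (W : 'F_2 -> Y -> R)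
    (n : nat) (y : 'rV[Y]_(2 ^ n)) (u : 'rV['F_2]_(2 ^ n)) : R :=
  \prod_(i < 2 ^ n) W ((u *m polar_mx n) 0 i) (y 0 i).

(* W_N^(i)(y, u_1^(i-1) | b).  Of the word [u] only the entries before [i]
   are used; [v] ranges over the words made of this prefix, the bit [b] and an
   arbitrary continuation. *)
Definition subchannel (R : realType) (Y : finType) (W : 'F_2 -> Y -> R)
    (n : nat) (i : 'I_(2 ^ n)) (y : 'rV[Y]_(2 ^ n)) (u : 'rV['F_2]_(2 ^ n))
    (b : 'F_2) : R :=
  \sum_(v : 'rV['F_2]_(2 ^ n) |
        [forall j : 'I_(2 ^ n), (j < i)%N ==> (v 0 j == u 0 j)] && (v 0 i == b))
    (2 ^+ (2 ^ n - 1))^-1 * polar_channel W y v.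

(* log (a / b) for a, b >= 0, with values +oo at b = 0 < a and -oo at
   a = 0 < b.  The undefined case a = b = 0 is given the value 0, so that it
   counts as a tie. *)
Definition log_ratio (R : realType) (a b : R) : \bar R :=
  if (a == 0) && (b == 0) then 0%E else lne (a%:E / b%:E)%E.

Definition llr (R : realType) (Y : finType) (W : 'F_2 -> Y -> R)
    (n : nat) (i : 'I_(2 ^ n)) (y : 'rV[Y]_(2 ^ n)) (u : 'rV['F_2]_(2 ^ n)) :
    \bar R :=
  log_ratio (subchannel W i y u 0) (subchannel W i y u 1).

(* The first N - K1 bits of u, where K1 = 2 ^ k1. *)
Definition known_bits (n k1 : nat) (u : 'rV['F_2]_(2 ^ n)) :
    'rV['F_2]_(2 ^ n - 2 ^ k1) :=
  \row_j u 0 (widen_ord (leq_subr (2 ^ k1) (2 ^ n)) j).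

(* A decoder sees the channel output and the genie-supplied bits.  Its output
   is the whole word of estimates, of which the first N - K1 entries are
   required below to be the supplied bits. *)
Definition decoder (Y : finType) (n k1 : nat) : Type :=
  'rV[Y]_(2 ^ n) -> 'rV['F_2]_(2 ^ n - 2 ^ k1) -> 'rV['F_2]_(2 ^ n).

(* Ties are unconstrained: every function obeying the sign rule qualifies. *)
Definition is_SC_decoder (R : realType) (Y : finType) (W : 'F_2 -> Y -> R)
    (n k1 : nat) (dec : decoder Y n k1) : Prop :=
  forall (y : 'rV[Y]_(2 ^ n)) (p : 'rV['F_2]_(2 ^ n - 2 ^ k1)),
    known_bits k1 (dec y p) = p /\
    forall i : 'I_(2 ^ n), (2 ^ n - 2 ^ k1 <= i)%N ->
      ((0 < llr W i y (dec y p))%E -> dec y p 0 i = 0) /\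
      ((llr W i y (dec y p) < 0)%E -> dec y p 0 i = 1).

Definition is_ML_decoder (R : realType) (Y : finType) (W : 'F_2 -> Y -> R)
    (n k1 : nat) (dec : decoder Y n k1) : Prop :=
  forall (y : 'rV[Y]_(2 ^ n)) (p : 'rV['F_2]_(2 ^ n - 2 ^ k1)),
    known_bits k1 (dec y p) = p /\
    forall v : 'rV['F_2]_(2 ^ n), known_bits k1 v = p ->
      polar_channel W y v <= polar_channel W y (dec y p).

(* Probability of the input word u when the bits are independent, uniform on
   the unfrozen set A and equal to 0 outside A. *)
Definition input_prob (R : realType) (n : nat) (A : {set 'I_(2 ^ n)})
    (u : 'rV['F_2]_(2 ^ n)) : R :=
  \prod_(i < 2 ^ n) (if i \in A then 2^-1 else (u 0 i == 0)%:R).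

Definition decoding_error (Y : finType) (n k1 : nat) (dec : decoder Y n k1)
    (y : 'rV[Y]_(2 ^ n)) (u : 'rV['F_2]_(2 ^ n)) : bool :=
  [exists i : 'I_(2 ^ n),
     (2 ^ n - 2 ^ k1 <= i)%N && (dec y (known_bits k1 u) 0 i != u 0 i)].

Definition error_prob (R : realType) (Y : finType) (W : 'F_2 -> Y -> R)
    (n k1 : nat) (A : {set 'I_(2 ^ n)}) (dec : decoder Y n k1) : R :=
  \sum_(u : 'rV['F_2]_(2 ^ n)) \sum_(y : 'rV[Y]_(2 ^ n) | decoding_error dec y u)
    input_prob R A u * polar_channel W y u.

(* {N - m + 1, ..., N}, for m <= N. *)
Definition last_indices (n m : nat) : {set 'I_(2 ^ n)} :=
  [set i : 'I_(2 ^ n) | (2 ^ n - m <= i)%N].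

(* Main.v *)
(* The last [2 ^ k1] rows of the polar transform form a repeated copy of a
   smaller polar transform, so once the first [N - K1] bits are known the code
   is a rate-one polar code over a product of binary channels.  On a rate-one
   code successive cancellation reproduces the symbolwise hard decision of every
   channel: if [a] maximizes the combined channel [sum_t q (s + t) q' t] and [b]
   then maximizes [q (a + t) q' t], then [a + b] maximizes [q] and [b] maximizes
   [q'], unless some channel is identically zero, and then so is the likelihood.
   Hence every SC decoder, however it breaks ties, is an ML decoder, and
   all ML decoders have the same error probability. *)
Require Import Defs.
From mathcomp Require Import all_boot all_order all_algebra.
From mathcomp Require Import mxtens.
From mathcomp Require Import reals constructive_ereal exp.
From mathcomp Require Import zify lra.

Set Implicit Arguments.
Unset Strict Implicit.
Unset Printing Implicit Defensive.

Import Order.TTheory GRing.Theory Num.Theory.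
Local Open Scope ring_scope.

(** * Arithmetic in ['F_2] and sums over row vectors *)

Lemma F2_eq01 (x : 'F_2) : x = 0 \/ x = 1.
Proof. by case: x => [[|[|//]] lt_x]; [left | right]; apply: val_inj. Qed.

Lemma F2_addxx (x : 'F_2) : x + x = 0.
Proof. by case: (F2_eq01 x) => ->; apply: val_inj. Qed.

Lemma F2_neq (x y : 'F_2) : x != y -> y = x + 1.
Proof.
by case: (F2_eq01 x) => ->; case: (F2_eq01 y) => -> // _; apply: val_inj.
Qed.

Lemma F2_sum (V : nmodType) (f : 'F_2 -> V) (x : 'F_2) :
  \sum_t f t = f x + f (x + 1).
Proof.
rewrite (bigD1 x) //= (bigD1 (x + 1)) /=.
  rewrite big1 ?addr0 // => t /andP[+ +].
  rewrite eq_sym => /F2_neq tE.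
  by rewrite -tE eqxx.
by case: (F2_eq01 x) => ->.
Qed.

Lemma row_mx_sum (R : nmodType) (T : finType) (m n : nat)
    (P : pred 'rV[T]_(m + n)) (f : 'rV[T]_(m + n) -> R) :
  \sum_(v | P v) f v
  = \sum_(a : 'rV[T]_m) \sum_(b : 'rV[T]_n | P (row_mx a b)) f (row_mx a b).
Proof.
rewrite pair_big_dep /=.
rewrite (reindex (fun p : 'rV[T]_m * 'rV[T]_n => row_mx p.1 p.2)) //=.
exists (fun v => (lsubmx v, rsubmx v)) => [[a b]|v] _ /=.
  by rewrite row_mxKl row_mxKr.
by rewrite hsubmxK.
Qed.

Lemma sum_prod_row (R : comNzRingType) (T : finType) (m : nat)
    (f : 'I_m -> T -> R) :
  \sum_(x : 'rV[T]_m) \prod_i f i (x 0 i) = \prod_i \sum_t f i t.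
Proof.
rewrite bigA_distr_bigA /=.
rewrite (reindex (fun g : {ffun 'I_m -> T} => \row_i g i)) /=.
  by apply: eq_bigr => g _; apply: eq_bigr => i _; rewrite mxE.
exists (fun x : 'rV[T]_m => [ffun i => x 0 i]) => x _.
  by apply/ffunP => i; rewrite ffunE mxE.
by apply/rowP => i; rewrite mxE ffunE.
Qed.

(** * Likelihoods, marginals and channel combining *)

(** [q i t] stands for W(y_i|t) with the output fixed; letting it vary with [i] makes such families
    closed under channel combining. *)
Definition likelihood (R : realType) (N : nat) (G : 'M['F_2]_N)
    (q : 'I_N -> 'F_2 -> R) (u : 'rV['F_2]_N) : R :=
  \prod_i q i ((u *m G) 0 i).

Definition extends (N : nat) (i : 'I_N) (u : 'rV['F_2]_N) (t : 'F_2)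
    (v : 'rV['F_2]_N) : bool :=
  [forall j : 'I_N, (j < i)%N ==> (v 0 j == u 0 j)] && (v 0 i == t).

Definition marginal (R : realType) (N : nat) (G : 'M['F_2]_N)
    (q : 'I_N -> 'F_2 -> R) (i : 'I_N) (u : 'rV['F_2]_N) (t : 'F_2) : R :=
  \sum_(v | extends i u t v) likelihood G q v.

(** The inequality is weak, so at a tie both bits are admissible. *)
Definition sc_choice (R : realType) (N : nat) (G : 'M['F_2]_N)
    (q : 'I_N -> 'F_2 -> R) (u : 'rV['F_2]_N) (i : 'I_N) : Prop :=
  forall t, marginal G q i u t <= marginal G q i u (u 0 i).

(* [2 ^ n], arranged so that [len n.+1] is convertible to [len n + len n] and
   block matrices need no casts. *)
Fixpoint len (n : nat) : nat := if n is n'.+1 then len n' + len n' else 1.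

Lemma lenE (n : nat) : len n = (2 ^ n)%N.
Proof. by elim: n => //= n ->; rewrite expnS mul2n addnn. Qed.

Fixpoint kernel_mx (n : nat) : 'M['F_2]_(len n) :=
  if n is n'.+1 return 'M_(len n) then
    block_mx (kernel_mx n') 0 (kernel_mx n') (kernel_mx n')
  else 1%:M.

Lemma mul_row_kernel_mx (n : nat) (a b : 'rV['F_2]_(len n)) :
  row_mx a b *m kernel_mx n.+1
  = row_mx (a *m kernel_mx n + b *m kernel_mx n) (b *m kernel_mx n).
Proof. by rewrite /= mul_row_block mulmx0 add0r. Qed.

Lemma kernel_mx_unit (n : nat) : kernel_mx n \in unitmx.
Proof.
elim: n => [|n IHn] /=; first exact: unitmx1.
by rewrite unitmxE det_lblock unitrM -unitmxE IHn.
Qed.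

(* Arikan's channel combining, in which the first half [a] of a codeword pair
   [(a + b, b)] is decoded first and the second half is decoded given [a]. *)
Definition minus_channel (R : realType) (m : nat)
    (q : 'I_(m + m) -> 'F_2 -> R) (i : 'I_m) (s : 'F_2) : R :=
  \sum_t q (lshift m i) (s + t) * q (rshift m i) t.

Definition plus_channel (R : realType) (m : nat)
    (q : 'I_(m + m) -> 'F_2 -> R) (a : 'rV['F_2]_m) (i : 'I_m) (t : 'F_2) : R :=
  q (lshift m i) (a 0 i + t) * q (rshift m i) t.

(** Once [a] is fixed, coordinate [i] of both codeword halves depends on a single bit, so the two
    factors merge into one channel. *)
Lemma likelihood_plus (R : realType) (n : nat) (q : 'I_(len n.+1) -> 'F_2 -> R)
    (a b : 'rV['F_2]_(len n)) :
  likelihood (kernel_mx n.+1) q (row_mx a b)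
  = likelihood (kernel_mx n) (plus_channel q (a *m kernel_mx n)) b.
Proof.
rewrite /likelihood mul_row_kernel_mx (@big_split_ord _ _ _ (len n) (len n)).
rewrite /= -big_split /=.
by apply: eq_bigr => i _; rewrite row_mxEl row_mxEr mxE.
Qed.

(** The kernel is invertible, so the encoded second half runs over all words and the sum factors by
    coordinates. *)
Lemma likelihood_minus (R : realType) (n : nat) (q : 'I_(len n.+1) -> 'F_2 -> R)
    (a : 'rV['F_2]_(len n)) :
  \sum_b likelihood (kernel_mx n.+1) q (row_mx a b)
  = likelihood (kernel_mx n) (minus_channel q) a.
Proof.
under eq_bigr do rewrite likelihood_plus.
rewrite {2}/likelihood -sum_prod_row.
rewrite [RHS](reindex (mulmxr (kernel_mx n))) //=.
exists (mulmxr (invmx (kernel_mx n))) => x _ /=.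
  by rewrite mulmxK // kernel_mx_unit.
by rewrite mulmxKV // kernel_mx_unit.
Qed.

Lemma extends_lshift (m : nat) (i : 'I_m) (a b c d : 'rV['F_2]_m) (t : 'F_2) :
  extends (lshift m i) (row_mx a b) t (row_mx c d) = extends i a t c.
Proof.
rewrite /extends row_mxEl; congr (_ && _).
apply/forallP/forallP => H j; first by have := H (lshift m j); rewrite !row_mxEl.
apply/implyP; case: (split_ordP j) => k -> /=.
  by rewrite !row_mxEl; move/implyP: (H k).
move=> lt_k; have := ltn_ord i.
by rewrite ltnNge (leq_trans _ (ltnW lt_k)) // leq_addr.
Qed.

Lemma extends_rshift (m : nat) (i : 'I_m) (a b c d : 'rV['F_2]_m) (t : 'F_2) :
  extends (rshift m i) (row_mx a b) t (row_mx c d) = (c == a) && extends i b t d.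
Proof.
rewrite /extends row_mxEr andbA; congr (_ && _).
apply/forallP/andP => [H|[/eqP -> /forallP H] j].
  split; last first.
    apply/forallP => j; have := H (rshift m j).
    by rewrite !row_mxEr /= ltn_add2l.
  apply/eqP/rowP => j; have := H (lshift m j).
  by rewrite !row_mxEl /= ltn_addr ?ltn_ord //= => /eqP.
apply/implyP; case: (split_ordP j) => k -> /=; first by rewrite !row_mxEl.
by rewrite !row_mxEr ltn_add2l; move/implyP: (H k).
Qed.

Lemma marginal_minus (R : realType) (n : nat) (q : 'I_(len n.+1) -> 'F_2 -> R)
    (a b : 'rV['F_2]_(len n)) (i : 'I_(len n)) (t : 'F_2) :
  marginal (kernel_mx n.+1) q (lshift (len n) i) (row_mx a b) t
  = marginal (kernel_mx n) (minus_channel q) i a t.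
Proof.
rewrite /marginal row_mx_sum [RHS]big_mkcond /=; apply: eq_bigr => c _.
under eq_bigl do rewrite extends_lshift.
by case: ifP => _; [exact: likelihood_minus | rewrite big_pred0_eq].
Qed.

Lemma marginal_plus (R : realType) (n : nat) (q : 'I_(len n.+1) -> 'F_2 -> R)
    (a b : 'rV['F_2]_(len n)) (i : 'I_(len n)) (t : 'F_2) :
  marginal (kernel_mx n.+1) q (rshift (len n) i) (row_mx a b) t
  = marginal (kernel_mx n) (plus_channel q (a *m kernel_mx n)) i b t.
Proof.
rewrite /marginal row_mx_sum (bigD1 a) //= [X in _ + X]big1 ?addr0.
  under eq_bigl do rewrite extends_rshift eqxx.
  by apply: eq_bigr => d _; apply: likelihood_plus.
by move=> c /negPf ne_ca; rewrite big_pred0 // => d; rewrite extends_rshift ne_ca.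
Qed.

(** Ensures that combining two channels that are not identically zero gives another such channel. *)
Lemma minus_channel_sum (R : realType) (m : nat)
    (q : 'I_(m + m) -> 'F_2 -> R) (i : 'I_m) :
  \sum_s minus_channel q i s
  = (\sum_t q (lshift m i) t) * (\sum_t q (rshift m i) t).
Proof.
rewrite /minus_channel exchange_big mulr_sumr /=; apply: eq_bigr => t _.
by rewrite -mulr_suml [in RHS](reindex_inj (addIr t)).
Qed.

(** * Successive cancellation and hard decisions *)

(** Primes mark flipped bits. The first comparison reads [(f - f') * (g - g') >= 0], so the two
    decisions cannot be strictly right and strictly wrong; the second excludes the remaining bad
    cases. *)
Lemma combine_decisions (R : realType) (f g f' g' : R) :
  0 <= f -> 0 <= g -> 0 <= f' -> 0 <= g' -> 0 < f + f' -> 0 < g + g' ->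
  f' * g + f * g' <= f * g + f' * g' -> f' * g' <= f * g ->
  f' <= f /\ g' <= g.
Proof.
move=> f0 g0 f'0 g'0 ff gg minus plus.
have key (a a' b b' : R) :
    0 <= a -> 0 <= a' -> 0 <= b -> 0 <= b' -> 0 < b + b' ->
    a' * b + a * b' <= a * b + a' * b' -> a' * b' <= a * b -> a' <= a.
  move=> a0 a'0 b0 b'0 bb mi pl; rewrite leNgt; apply/negP => lt.
  have le_b : b <= b'.
    by rewrite -subr_ge0 -(pmulr_rge0 _ (_ : 0 < a' - a)) ?subr_gt0 //; lra.
  (* Here [a' * b <= a' * b' <= a * b] while [a < a']. *)
  have b_eq0 : b = 0.
    apply/le_anti; rewrite b0 andbT -(pmulr_rle0 _ (_ : 0 < a' - a)) ?subr_gt0 //.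
    have := ler_wpM2l a'0 le_b; lra.
  have : 0 < a' * b' by apply: mulr_gt0; lra.
  by rewrite b_eq0 in pl; lra.
by split; [apply: (key f f' g g')|apply: (key g g' f f')]; lra.
Qed.

(* A channel with [q i 0 = q i 1 = 0] must be excluded: it turns every later
   comparison into a tie, which may be broken against another channel. *)
Lemma sc_hard_decision (R : realType) (n : nat) (q : 'I_(len n) -> 'F_2 -> R)
    (u : 'rV['F_2]_(len n)) :
  (forall i t, 0 <= q i t) -> (forall i, 0 < \sum_t q i t) ->
  (forall i, sc_choice (kernel_mx n) q u i) ->
  forall i t, q i t <= q i ((u *m kernel_mx n) 0 i).
Proof.
elim: n q u => [|n IHn] q u q_ge0 q_gt0 sc.
  have margE i t : marginal (kernel_mx 0) q i u t = q i t.
    rewrite /marginal (big_pred1 (const_mx t)) => [|v].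
      by rewrite /likelihood /= mulmx1 big_ord1 mxE (ord1 i).
    rewrite /extends (ord1 i) /=; apply/andP/eqP => [[_ /eqP <-]|->].
      by apply/rowP => j; rewrite mxE ord1.
    by split; [apply/forallP | rewrite mxE].
  by move=> i t; rewrite mulmx1 -!margE; apply: sc.
rewrite -[u]hsubmxK in sc *.
move: (lsubmx u) (rsubmx u) sc => a b sc.
set x := a *m kernel_mx n.
have minus_ge0 i s : 0 <= minus_channel q i s.
  by apply: sumr_ge0 => r _; apply: mulr_ge0.
have minus_sum_gt0 i : 0 < \sum_s minus_channel q i s.
  by rewrite minus_channel_sum mulr_gt0 // q_gt0.
have minus_max i s : minus_channel q i s <= minus_channel q i (x 0 i).
  apply: IHn => // j r.
  by have := sc (lshift _ j) r; rewrite !row_mxEl !(marginal_minus q).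
have plus_max i s :
    plus_channel q x i s <= plus_channel q x i ((b *m kernel_mx n) 0 i).
  apply: IHn => [j r|j|j r]; first by apply: mulr_ge0.
    (* The total mass of the plus channel is the minus channel at its maximizer, which is positive
       since the minus channel is not identically zero. *)
    have -> : \sum_t plus_channel q x j t = minus_channel q j (x 0 j) by [].
    have := minus_sum_gt0 j; rewrite (F2_sum _ (x 0 j)).
    have := minus_max j (x 0 j + 1); lra.
  by have := sc (rshift _ j) r; rewrite !row_mxEr !(marginal_plus q).
rewrite mul_row_kernel_mx -/x; set y := b *m kernel_mx n in plus_max *.
have decided i :
    q (lshift _ i) (x 0 i + (y 0 i + 1)) <= q (lshift _ i) (x 0 i + y 0 i) /\
    q (rshift _ i) (y 0 i + 1) <= q (rshift _ i) (y 0 i).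
  (* Flipping [x 0 i] in the minus channel yields the products with exactly one factor flipped;
     flipping [y 0 i] in the plus channel yields the product with both flipped. *)
  have := minus_max i (x 0 i + 1); have := plus_max i (y 0 i + 1).
  have := q_gt0 (rshift _ i); have := q_gt0 (lshift _ i).
  rewrite (F2_sum _ (x 0 i + y 0 i)) /minus_channel /plus_channel.
  rewrite !(F2_sum _ (y 0 i)) -!addrA.
  rewrite [1 + y 0 i]addrC [1 + (y 0 i + 1)]addrC -!addrA F2_addxx addr0.
  move=> ff gg plus minus.
  by apply: combine_decisions plus.
move=> i t; case: (split_ordP i) => k ->; rewrite ?row_mxEl ?row_mxEr.
  rewrite [(x + y) 0 k]mxE.
  have [<-//|/F2_neq ->] := eqVneq (x 0 k + y 0 k) t.
  by rewrite -addrA; case: (decided k).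
by have [<-//|/F2_neq ->] := eqVneq (y 0 k) t; case: (decided k).
Qed.

(** Without an identically zero channel the bound holds factor by factor; with one, the left side is
    0. *)
Lemma sc_maximizes_likelihood_rate1 (R : realType) (n : nat)
    (q : 'I_(len n) -> 'F_2 -> R) (u v : 'rV['F_2]_(len n)) :
  (forall i t, 0 <= q i t) -> (forall i, sc_choice (kernel_mx n) q u i) ->
  likelihood (kernel_mx n) q v <= likelihood (kernel_mx n) q u.
Proof.
move=> q_ge0 sc; have [q_gt0|] := boolP [forall i, 0 < \sum_t q i t].
  apply: ler_prod => i _; rewrite q_ge0 /=.
  exact: (sc_hard_decision q_ge0 (forallP q_gt0) sc).
rewrite negb_forall => /existsP[i]; rewrite -leNgt => q_le0.
rewrite [leLHS](_ : _ = 0); first by apply: prodr_ge0.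
have /eqP : \sum_t q i t = 0 by apply/le_anti; rewrite q_le0 sumr_ge0.
rewrite psumr_eq0 // => /allP qi0.
rewrite /likelihood (bigD1 i) //=.
by rewrite (eqP (qi0 ((v *m kernel_mx n) 0 i) (mem_index_enum _))) mul0r.
Qed.

(** While [k] is below the exponent, the known bits cover the first half, which [plus_channel]
    absorbs; the descent stops at a rate-one code of length [len k]. *)
Lemma sc_maximizes_likelihood (R : realType) (n k : nat)
    (q : 'I_(len n) -> 'F_2 -> R) (u v : 'rV['F_2]_(len n)) :
  (k <= n)%N -> (forall i t, 0 <= q i t) ->
  (forall i : 'I_(len n), (len n - len k <= i)%N ->
    sc_choice (kernel_mx n) q u i) ->
  (forall i : 'I_(len n), (i < len n - len k)%N -> v 0 i = u 0 i) ->
  likelihood (kernel_mx n) q v <= likelihood (kernel_mx n) q u.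
Proof.
elim: n => [|n IHn] in q u v *;
  rewrite leq_eqVlt => /orP[/eqP ->|lt_kn] // q_ge0 sc eq_uv.
- by apply: sc_maximizes_likelihood_rate1 => // i; apply: sc; rewrite subnn.
- by apply: sc_maximizes_likelihood_rate1 => // i; apply: sc; rewrite subnn.
have le_len : (len k <= len n)%N by rewrite !lenE leq_exp2l.
have subE : (len n.+1 - len k = len n + (len n - len k))%N by rewrite addnBA.
rewrite subE in sc eq_uv.
rewrite -[u]hsubmxK -[v]hsubmxK in sc eq_uv *.
move: (lsubmx u) (rsubmx u) (lsubmx v) (rsubmx v) sc eq_uv => a b c d sc eq_uv.
have -> : c = a.
  apply/rowP => i; have := eq_uv (lshift _ i); rewrite !row_mxEl; apply.
  by rewrite /= ltn_addr.
rewrite !likelihood_plus; apply: IHn => // [i t|i le_i t|i lt_i].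
- exact: mulr_ge0.
- have := sc (rshift _ i) _ t; rewrite !row_mxEr !(marginal_plus q); apply.
  by rewrite /= leq_add2l.
- by have := eq_uv (rshift _ i); rewrite !row_mxEr; apply; rewrite /= ltn_add2l.
Qed.

(** * Binary digits and bit reversal *)

Definition bit (x k : nat) : bool := odd (x %/ 2 ^ k).

Lemma bit_addM (c x n k : nat) : (k < n)%N -> bit (c * 2 ^ n + x) k = bit x k.
Proof.
(* For [k < n], [2 ^ n] is an even multiple of [2 ^ k], so the parity of the quotient does not
   change. *)
move=> lt_kn; rewrite /bit -(subnKC lt_kn) addSn -addnS expnD mulnCA mulnC.
rewrite divnMDl ?expn_gt0 // oddD expnS !oddM /=.
by rewrite andbF.
Qed.

Lemma bit_mod (x n k : nat) : (k < n)%N -> bit (x %% 2 ^ n) k = bit x k.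
Proof. by move=> lt_kn; rewrite [in RHS](divn_eq x (2 ^ n)) bit_addM. Qed.

Lemma bit_small (x n : nat) : (x < 2 ^ n)%N -> bit x n = false.
Proof. by move=> lt_x; rewrite /bit divn_small. Qed.

Lemma bit_top (x n : nat) : (x < 2 ^ n)%N -> bit (2 ^ n + x) n.
Proof. by move=> lt_x; rewrite /bit divnDl // divnn expn_gt0 divn_small. Qed.

Lemma modn_pow2S (x n : nat) : (x %% 2 ^ n.+1 = bit x n * 2 ^ n + x %% 2 ^ n)%N.
Proof.
rewrite [LHS](divn_eq _ (2 ^ n)) modn_dvdm ?dvdn_exp2l //.
by rewrite /bit -modn2 modn_divl -expnS.
Qed.

Lemma bit_inj (n x y : nat) : (x < 2 ^ n)%N -> (y < 2 ^ n)%N ->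
  (forall k, (k < n)%N -> bit x k = bit y k) -> x = y.
Proof.
move=> lt_x lt_y eq_bit; rewrite -(modn_small lt_x) -(modn_small lt_y).
elim: n eq_bit {lt_x lt_y} => [|n IHn] eq_bit; first by rewrite !modn1.
by rewrite !modn_pow2S eq_bit // IHn // => k lt_kn; apply: eq_bit; apply: ltnW.
Qed.

Lemma bits_sum (n : nat) (c : nat -> bool) :
  (\sum_(k < n) c k * 2 ^ k < 2 ^ n)%N /\
  forall k, (k < n)%N -> bit (\sum_(k < n) c k * 2 ^ k) k = c k.
Proof.
elim: n => [|n [lt_s bit_s]]; first by rewrite big_ord0.
rewrite big_ord_recr /= addnC; split.
  by rewrite expnS mul2n -addnn -addnS leq_add //; case: (c n); rewrite ?mul1n.
move=> k; rewrite ltnS leq_eqVlt => /orP[/eqP ->|lt_kn].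
  by case: (c n); rewrite ?mul1n ?mul0n ?add0n ?bit_top ?bit_small.
by rewrite bit_addM // bit_s.
Qed.

(** Summing from the other end gives the form handled by [bits_sum]. *)
Lemma bitrevE (n i : nat) :
  bitrev n i = (\sum_(k < n) bit i (n - k.+1) * 2 ^ k)%N.
Proof.
rewrite /bitrev (reindex_inj rev_ord_inj) /=; apply: eq_bigr => k _.
by congr (_ * 2 ^ _)%N; have := ltn_ord k; lia.
Qed.

Lemma bitrev_lt (n i : nat) : (bitrev n i < 2 ^ n)%N.
Proof. by rewrite bitrevE; case: (bits_sum n (fun k => bit i (n - k.+1))). Qed.

Lemma bit_bitrev (n i k : nat) : (k < n)%N ->
  bit (bitrev n i) k = bit i (n - k.+1).
Proof.
by rewrite bitrevE; case: (bits_sum n (fun k => bit i (n - k.+1))) => _; apply.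
Qed.

Definition bitrev_ord (n : nat) (i : 'I_(2 ^ n)) : 'I_(2 ^ n) :=
  Ordinal (bitrev_lt n i).

Lemma bitrev_ordK (n : nat) : involutive (@bitrev_ord n).
Proof.
move=> i; apply/val_inj/(@bit_inj n) => /= [||k lt_kn]; rewrite ?bitrev_lt //.
by rewrite !bit_bitrev; [congr bit; lia | lia | lia].
Qed.

(** * Entries of the kernel and of the polar matrix *)

(** Digitwise order, equivalently the parity of the binomial coefficient of [i] over [j] for indices
    below [2 ^ n]; it links the block recursion to the Kronecker power. *)
Definition subbits (n i j : nat) : bool :=
  \big[andb/true]_(k < n) (bit j k ==> bit i k).

Lemma subbitsS (n i j : nat) :
  subbits n.+1 i j = subbits n i j && (bit j n ==> bit i n).
Proof. by rewrite /subbits big_ord_recr. Qed.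

Lemma eq_subbits (n i i' j j' : nat) :
  (forall k, (k < n)%N -> bit i k = bit i' k) ->
  (forall k, (k < n)%N -> bit j k = bit j' k) ->
  subbits n i j = subbits n i' j'.
Proof. by move=> ei ej; apply: eq_bigr => k _; rewrite ei ?ej. Qed.

Lemma subbits_bitrev (n i j : nat) :
  subbits n (bitrev n i) j = subbits n i (bitrev n j).
Proof.
rewrite /subbits (reindex_inj rev_ord_inj) /=; apply: eq_bigr => k _.
rewrite !bit_bitrev //; last by have := ltn_ord k; lia.
by congr (_ ==> bit _ _); have := ltn_ord k; lia.
Qed.

(** Top digits select the block; the zero block is the one where [j] has top digit 1 and [i] has
    0. *)
Lemma kernel_mxE (n : nat) (i j : 'I_(len n)) :
  kernel_mx n i j = (subbits n i j)%:R.
Proof.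
elim: n i j => [|n IHn] i j.
  by rewrite /subbits big_ord0 (ord1 i) (ord1 j) mxE eqxx.
have lt2 (k : 'I_(len n)) : (k < 2 ^ n)%N by rewrite -lenE.
have top (k : 'I_(len n)) : bit (len n + k) n.
    by have := bit_top (lt2 k); rewrite -lenE.
have low (k l : nat) : (l < n)%N -> bit (len n + k) l = bit k l.
  by move=> lt_ln; rewrite lenE -[(2 ^ n)%N]mul1n bit_addM.
rewrite subbitsS /=.
case: (split_ordP i) => i' ->; case: (split_ordP j) => j' -> /=.
- by rewrite block_mxEul IHn bit_small // andbT.
- by rewrite block_mxEur mxE top bit_small // andbF.
- rewrite block_mxEdl IHn top implybT andbT.
  by rewrite (eq_subbits (low i') (fun _ _ => erefl)).
- by rewrite block_mxEdr IHn !top andbT (eq_subbits (low i') (low j')).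
Qed.

Lemma G2E (i j : 'I_2) : G2 i j = (odd j ==> odd i)%:R.
Proof. by rewrite mxE; case: i j => [[|[|//]] ?] [[|[|//]] ?]. Qed.

Lemma G2_tensE (n : nat) (i j : 'I_(2 ^ n)) : (G2 ^t n) i j = (subbits n i j)%:R.
Proof.
case: n => [|n] in i j *.
  by rewrite /subbits big_ord0 ntensmx0 (ord1 i) (ord1 j) mxE eqxx.
elim: n => [|n IHn] in i j *.
  by rewrite ntensmx1 G2E /subbits big_ord1 /bit expn0 !divn1.
rewrite ntensmxSS /tensmx mxE IHn G2E [in RHS]subbitsS -natrM mulnb andbC /=.
(* The tensor index splits into its top digit (quotient) and its lower digits (remainder). *)
by rewrite (eq_subbits (@bit_mod i n.+1) (@bit_mod j n.+1)).
Qed.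

Lemma polar_mxE (n : nat) (i j : 'I_(2 ^ n)) :
  polar_mx n i j = (subbits n i (bitrev n j))%:R.
Proof.
rewrite mxE (bigD1 (bitrev_ord i)) //= big1 ?addr0 => [|k /negPf ne_k].
  by rewrite mxE eqxx mul1r G2_tensE subbits_bitrev.
by rewrite mxE -[bitrev n i]/(val (bitrev_ord i)) val_eqE ne_k mul0r.
Qed.

(** Reversing the row indices of the Kronecker power amounts to reversing its column indices, so bit
    reversal only permutes the channel uses and leaves the decoding order intact. *)
Lemma likelihood_polar_mx (R : realType) (n : nat)
    (q : 'I_(2 ^ n) -> 'F_2 -> R) (u : 'rV['F_2]_(2 ^ n)) :
  likelihood (polar_mx n) q u
  = likelihood (\matrix_(i, j) (subbits n i j)%:R) (q \o @bitrev_ord n) u.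
Proof.
rewrite /likelihood (reindex_inj (inv_inj (@bitrev_ordK n))) /=.
apply: eq_bigr => i _; congr (q _ _); rewrite !mxE; apply: eq_bigr => j _.
rewrite polar_mxE mxE.
rewrite -[bitrev n (bitrev_ord i)]/(val (bitrev_ord (bitrev_ord i))).
by rewrite bitrev_ordK.
Qed.

(** A variable [N] with an equation lets substitution carry the types from [2 ^ n] to [len n]. *)
Lemma sc_maximizes_subbits (R : realType) (N n k : nat)
    (q : 'I_N -> 'F_2 -> R) (u v : 'rV['F_2]_N) :
  let G := \matrix_(i, j) (subbits n i j)%:R in
  N = (2 ^ n)%N -> (k <= n)%N -> (forall i t, 0 <= q i t) ->
  (forall i : 'I_N, (N - 2 ^ k <= i)%N -> sc_choice G q u i) ->
  (forall i : 'I_N, (i < N - 2 ^ k)%N -> v 0 i = u 0 i) ->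
  likelihood G q v <= likelihood G q u.
Proof.
rewrite -!lenE => G eN; subst N.
have -> : G = kernel_mx n by apply/matrixP => i j; rewrite kernel_mxE mxE.
exact: sc_maximizes_likelihood.
Qed.

Lemma sc_maximizes_polar (R : realType) (n k : nat)
    (q : 'I_(2 ^ n) -> 'F_2 -> R) (u v : 'rV['F_2]_(2 ^ n)) :
  (k <= n)%N -> (forall i t, 0 <= q i t) ->
  (forall i : 'I_(2 ^ n), (2 ^ n - 2 ^ k <= i)%N ->
    sc_choice (polar_mx n) q u i) ->
  (forall i : 'I_(2 ^ n), (i < 2 ^ n - 2 ^ k)%N -> v 0 i = u 0 i) ->
  likelihood (polar_mx n) q v <= likelihood (polar_mx n) q u.
Proof.
move=> le_kn q_ge0 sc eq_uv; rewrite !likelihood_polar_mx.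
apply: (@sc_maximizes_subbits _ _ n k) => // [i t|i le_i t]; first exact: q_ge0.
rewrite /marginal; under eq_bigr do rewrite -likelihood_polar_mx.
under [leRHS]eq_bigr do rewrite -likelihood_polar_mx.
exact: sc.
Qed.

(** * From log-likelihood ratios to maximum likelihood *)

Lemma log_ratio_gt0 (R : realType) (a b : R) :
  0 <= b -> b < a -> (0 < log_ratio a b)%E.
Proof.
move=> b_ge0 lt_ba; have a_gt0 := le_lt_trans b_ge0 lt_ba.
rewrite /log_ratio gt_eqF //= lne_gt0 inver.
(* At [b = 0] the extended inverse is [+oo]. *)
have [_|b_neq0] := eqVneq b 0; first by rewrite gt0_muley ?lte_fin // ltry.
by rewrite -EFinM lte_fin ltr_pdivlMr ?mul1r // lt_def b_neq0.
Qed.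

Lemma log_ratio_lt0 (R : realType) (a b : R) :
  0 <= a -> a < b -> (log_ratio a b < 0)%E.
Proof.
move=> a_ge0 lt_ab; have b_gt0 := le_lt_trans a_ge0 lt_ab.
rewrite /log_ratio (gt_eqF b_gt0) andbF lne_lt0 inver (gt_eqF b_gt0).
by rewrite -EFinM lte_fin ltr_pdivrMr ?mul1r.
Qed.

Lemma polar_channelE (R : realType) (Y : finType) (W : 'F_2 -> Y -> R)
    (n : nat) (y : 'rV[Y]_(2 ^ n)) (u : 'rV['F_2]_(2 ^ n)) :
  polar_channel W y u = likelihood (polar_mx n) (fun i t => W t (y 0 i)) u.
Proof. by []. Qed.

Lemma subchannelE (R : realType) (Y : finType) (W : 'F_2 -> Y -> R)
    (n : nat) (i : 'I_(2 ^ n)) (y : 'rV[Y]_(2 ^ n)) (u : 'rV['F_2]_(2 ^ n))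
    (t : 'F_2) :
  subchannel W i y u t
  = (2 ^+ (2 ^ n - 1))^-1
    * marginal (polar_mx n) (fun i t => W t (y 0 i)) i u t.
Proof. by rewrite /subchannel -mulr_sumr. Qed.

(** A chosen bit of strictly smaller marginal would force a nonzero ratio whose sign dictates the
    other bit. *)
Lemma llr_sc_choice (R : realType) (Y : finType) (W : 'F_2 -> Y -> R)
    (n : nat) (i : 'I_(2 ^ n)) (y : 'rV[Y]_(2 ^ n)) (u : 'rV['F_2]_(2 ^ n)) :
  (forall x y, 0 <= W x y) ->
  ((0 < llr W i y u)%E -> u 0 i = 0) -> ((llr W i y u < 0)%E -> u 0 i = 1) ->
  sc_choice (polar_mx n) (fun i t => W t (y 0 i)) u i.
Proof.
move=> W_ge0 llr_gt0 llr_lt0 t.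
rewrite -(ler_pM2l (_ : 0 < (2 ^+ (2 ^ n - 1))^-1)) ?invr_gt0 ?exprn_gt0 //.
rewrite -!subchannelE leNgt; apply/negP => lt_u.
have sub_ge0 s : 0 <= subchannel W i y u s.
  by apply: sumr_ge0 => v _; rewrite mulr_ge0 ?invr_ge0 ?exprn_ge0 ?prodr_ge0.
case: (F2_eq01 (u 0 i)) (F2_eq01 t) => ui [] tE; rewrite ui tE ?ltxx // in lt_u.
  by move: (llr_lt0 (log_ratio_lt0 (sub_ge0 _) lt_u)); rewrite ui.
by move: (llr_gt0 (log_ratio_gt0 (sub_ge0 _) lt_u)); rewrite ui.
Qed.

Lemma known_bits_eqP (n k1 : nat) (u v : 'rV['F_2]_(2 ^ n)) :
  known_bits k1 u = known_bits k1 v <->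
  forall i : 'I_(2 ^ n), (i < 2 ^ n - 2 ^ k1)%N -> u 0 i = v 0 i.
Proof.
split=> [eq_uv i lt_i|eq_uv]; last by apply/rowP => j; rewrite !mxE eq_uv /=.
have := congr1 (fun w : 'rV_ _ => w 0 (Ordinal lt_i)) eq_uv; rewrite !mxE.
by congr (u _ _ = v _ _); apply: val_inj.
Qed.

Lemma SC_decoder_is_ML (R : realType) (Y : finType) (W : 'F_2 -> Y -> R)
    (n k1 : nat) (dec : decoder Y n k1) :
  (forall x y, 0 <= W x y) -> (k1 <= n)%N ->
  is_SC_decoder W dec -> is_ML_decoder W dec.
Proof.
move=> W_ge0 le_k1n sc y p; have [dec_p sc_p] := sc y p.
split=> // v vp; rewrite !polar_channelE.
apply: (sc_maximizes_polar le_k1n) => // [i le_i|]; last first.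
  by apply/known_bits_eqP; rewrite vp dec_p.
by have [gt0 lt0] := sc_p i le_i; apply: llr_sc_choice.
Qed.

(** * Error probabilities *)

(** Factors on [A] are constant, and every index outside [A] is known. *)
Lemma input_prob_known_bits (R : realType) (n k1 : nat) (A : {set 'I_(2 ^ n)})
    (u v : 'rV['F_2]_(2 ^ n)) :
  last_indices n (2 ^ k1) \subset A -> known_bits k1 u = known_bits k1 v ->
  input_prob R A u = input_prob R A v.
Proof.
move=> /subsetP sub_A /known_bits_eqP eq_uv; apply: eq_bigr => i _.
case: ifPn => // /(contra (sub_A i)); rewrite inE -ltnNge => lt_i.
by rewrite eq_uv.
Qed.

Lemma decoding_error_neq (Y : finType) (n k1 : nat) (dec : decoder Y n k1)
    (y : 'rV[Y]_(2 ^ n)) (u : 'rV['F_2]_(2 ^ n)) :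
  known_bits k1 (dec y (known_bits k1 u)) = known_bits k1 u ->
  decoding_error dec y u = (dec y (known_bits k1 u) != u).
Proof.
move=> /known_bits_eqP dec_known.
apply/idP/idP => [/existsP[i /andP[_]]|]; first by apply: contraNneq => ->.
apply: contraNT; rewrite negb_exists => /forallP no_err; apply/eqP/rowP => i.
have [lt_i|le_i] := ltnP i (2 ^ n - 2 ^ k1); first exact: dec_known.
by have := no_err i; rewrite le_i /= negbK => /eqP.
Qed.

(* Given the output [y] and the known bits [p], only the word [dec y p] is
   decoded correctly. *)
Lemma error_prob_compl (R : realType) (Y : finType) (W : 'F_2 -> Y -> R)
    (n k1 : nat) (A : {set 'I_(2 ^ n)}) (dec : decoder Y n k1) :
  (forall y p, known_bits k1 (dec y p) = p) ->
  error_prob W A dec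
  = \sum_(u : 'rV['F_2]_(2 ^ n)) \sum_(y : 'rV[Y]_(2 ^ n))
      input_prob R A u * polar_channel W y u
    - \sum_(y : 'rV[Y]_(2 ^ n)) \sum_p
        input_prob R A (dec y p) * polar_channel W y (dec y p).
Proof.
move=> dec_known; apply/eqP; rewrite -subr_eq0 opprB addrA subr_eq0 addrC.
apply/eqP.
transitivity (\sum_(u : 'rV['F_2]_(2 ^ n))
    \sum_(y : 'rV[Y]_(2 ^ n) | ~~ decoding_error dec y u)
      input_prob R A u * polar_channel W y u + error_prob W A dec); last first.
  rewrite /error_prob -big_split /=; apply: eq_bigr => u _.
  by rewrite [RHS](bigID (decoding_error dec ^~ u)) /= addrC.
congr (_ + _); rewrite [RHS](exchange_big_dep xpredT) //=; apply: eq_bigr => y _.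
(* For fixed [y], the correctly decoded words are exactly the values [dec y p], one for each [p]. *)
rewrite [RHS](reindex_onto (dec y) (known_bits k1)) /=.
  apply: eq_bigl => p; rewrite dec_known eqxx andbT decoding_error_neq //.
  by rewrite dec_known eqxx.
by move=> u; rewrite decoding_error_neq // negbK => /eqP.
Qed.

(** In the complement formula, both decoders attain the same maximal likelihood for each [y] and
    [p], with the same prior. *)
Lemma eq_error_prob_ML (R : realType) (Y : finType) (W : 'F_2 -> Y -> R)
    (n k1 : nat) (A : {set 'I_(2 ^ n)}) (dec dec' : decoder Y n k1) :
  last_indices n (2 ^ k1) \subset A ->
  is_ML_decoder W dec -> is_ML_decoder W dec' ->
  error_prob W A dec = error_prob W A dec'.
Proof.
move=> sub_A ml ml'.
have known y p : known_bits k1 (dec y p) = p by have [] := ml y p.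
have known' y p : known_bits k1 (dec' y p) = p by have [] := ml' y p.
rewrite !error_prob_compl //; congr (_ - _).
apply: eq_bigr => y _; apply: eq_bigr => p _; congr (_ * _).
  by apply: (input_prob_known_bits _ sub_A); rewrite known known'.
have [_ max] := ml y p; have [_ max'] := ml' y p.
by apply/le_anti; rewrite max ?max'.
Qed.

Theorem theorem1 (R : realType) (Y : finType) (W : 'F_2 -> Y -> R)
  (n K k1 : nat) (A : {set 'I_(2 ^ n)})
  (W_dmc : is_dmc W)
  (card_A : #|A| = K)
  (N_in_A : last_indices n 1 \subset A)
  (k1_le_n : (k1 <= n)%N)
  (k1_suffix : last_indices n (2 ^ k1) \subset A)
  (k1_max : forall k : nat, (k <= n)%N -> last_indices n (2 ^ k) \subset A ->
            (k <= k1)%N)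
  (sc ml : decoder Y n k1)
  (sc_SC : is_SC_decoder W sc) (ml_ML : is_ML_decoder W ml) :
  error_prob W A sc = error_prob W A ml.
Proof.
have [W_ge0 _] := W_dmc.
by apply: eq_error_prob_ML => //; apply: SC_decoder_is_ML.
Qed.
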